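(* Let $\varphi$ be a satisfiable CNF formula and let $\psi$ be the CNF formula consisting of all prime implicates of $\varphi$. Then $\varphi$ is a PC formula if and only if $\mathrm{DR}(\varphi)$ and $\mathrm{DR}(\psi)$ are equivalent (as Boolean functions of the meta-variables).
   Context: A partial assignment $\alpha$ of variables $\mathbf{x}$ is a set of literals on $\mathbf{x}$ with no complementary pair, identified with the conjunction of its literals. Unit resolution derives $C\setminus\{l\}$ from a clause $C\ni l$ and the unit clause $\neg l$; $\varphi\vdash_1 C$ means derivability by repeated unit resolution; $\bot$ is the empty clause. $\varphi(\mathbf{x})$ is propagation complete (PC) if for every partial assignment $\alpha$ of $\mathbf{x}$ and every literal $l$ on $\mathbf{x}$ with $\varphi\wedge\alpha\models l$ we have $\varphi\wedge\alpha\vdash_1 l$ or $\varphi\wedge\alpha\vdash_1\bot$. Implicational dual rail encoding: for a CNF $\varphi$ on variables $\mathbf{x}$ not containing the empty clause, introduce a meta-variable $\ell_l$ for every literal $l$ on $\mathbf{x}$ (so $2|\mathbf{x}|$ meta-variables). Then $\mathrm{DR}(\varphi)$ is the CNF on the meta-variables consisting of the clause $\ell_l\vee\bigvee_{e\in C\setminus\{l\}}\neg\ell_{\neg e}$ (i.e. the implication $\bigwedge_{e\in C\setminus\{l\}}\ell_{\neg e}\to\ell_l$) for every pair $(C,l)$ with $l\in C\in\varphi$, together with the consistency clauses $\neg\ell_x\vee\neg\ell_{\neg x}$ for every $x\in\mathbf{x}$. Here $\mathrm{DR}(\varphi)$ and $\mathrm{DR}(\psi)$ are on the same set of meta-variables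 (those of the variables of $\varphi$). *)

(* Defs.v *)
From mathcomp Require Import all_boot.
Set Implicit Arguments.
Unset Strict Implicit.
Unset Printing Implicit Defensive.

(* (x, true) is the positive literal x, (x, false) the negative literal. *)
Definition literal (V : finType) : finType := (V * bool)%type.
Definition clause (V : finType) : finType := {set literal V}.
Definition cnf (V : finType) : finType := {set clause V}.

Section Formulas.
Variable V : finType.
Implicit Types (l e : literal V) (A C : {set literal V}) (F G : {set clause V})
  (a : {ffun V -> bool}).

Definition neg l : literal V := (l.1, ~~ l.2).

Definition no_complementary_pair A : bool := [forall l in A, neg l \notin A].

Definition lit_sat a l : bool := a l.1 == l.2.
Definition clause_sat a C : bool := [exists l in C, lit_sat a l].
Definition cnf_sat a F : bool := [forall C in F, clause_sat a C].

Definition satisfiable F : Prop := exists a, cnf_sat a F.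
Definition entails F C : bool := [forall a, cnf_sat a F ==> clause_sat a C].
Definition equivalent F G : Prop := forall a, cnf_sat a F = cnf_sat a G.

Inductive unit_derives F : {set literal V} -> Prop :=
| unit_derives_mem C : C \in F -> unit_derives F C
| unit_derives_res C l :
    unit_derives F C -> l \in C -> unit_derives F [set neg l] ->
    unit_derives F (C :\ l).

(* F /\ A, where the set of literals A stands for their conjunction. *)
Definition cnf_and F A : cnf V := F :|: [set [set l] | l in A].

Definition propagation_complete F : Prop :=
  forall A, no_complementary_pair A ->
  forall l, entails (cnf_and F A) [set l] ->
    unit_derives (cnf_and F A) [set l] \/ unit_derives (cnf_and F A) set0.

(* As usual, tautological clauses are not counted as implicates; a formula
   itself may contain them. *)
Definition implicate F C : bool := no_complementary_pair C && entails F C.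
Definition prime_implicates F : cnf V := [set C | minset (implicate F) C].

(* The meta-variable of l is l itself, so that DR F is a CNF over the variable
   type literal V, and (l, true), (l, false) are the literals on it. *)
Definition DR_implication C l : clause (literal V) :=
  (l, true) |: [set (neg e, false) | e in C :\ l].
Definition DR_consistency (x : V) : clause (literal V) :=
  [set ((x, true), false); ((x, false), false)].
Definition DR F : cnf (literal V) :=
  [set DR_implication C l | C in F, l in (C : {set literal V})]
  :|: [set DR_consistency x | x : V].

End Formulas.

(* Main.v *)
Require Import Defs.
From mathcomp Require Import all_boot.
Set Implicit Arguments.
Unset Strict Implicit.
Unset Printing Implicit Defensive.

(** Identify an assignment of the meta-variables with the set [S] of literals
    whose meta-variable is true.  Then [S] is a model of [DR phi] iff it is
    consistent and closed under unit propagation in [phi], whereas it is a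
    model of [DR psi] iff it is consistent and contains every literal entailed
    by [phi] and [S].  Propagation completeness says that these two closure
    conditions agree. *)

Section DualRail.
Variable V : finType.
Implicit Types (l e : literal V) (A C D S : {set literal V}) (F : cnf V).

(** * Satisfaction and entailment *)

Lemma negK : involutive (@neg V).
Proof. by case=> x b; rewrite /neg /= negbK. Qed.

Lemma no_complementary_pairP A :
  reflect (forall l, l \in A -> neg l \notin A) (no_complementary_pair A).
Proof. exact: 'forall_implyP. Qed.

Lemma lit_sat_neg (a : {ffun V -> bool}) l : lit_sat a (neg l) = ~~ lit_sat a l.
Proof. by rewrite /lit_sat /=; case: (a _); case: l.2. Qed.

Lemma clause_satP (W : finType) (a : {ffun W -> bool}) (C : clause W) :
  reflect (exists2 l : literal W, l \in C & lit_sat a l) (clause_sat a C).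
Proof. exact: exists_inP. Qed.

Lemma clause_sat1 (a : {ffun V -> bool}) l : clause_sat a [set l] = lit_sat a l.
Proof.
apply/clause_satP/idP => [[e /set1P ->] //|al].
by exists l; rewrite ?set11.
Qed.

Lemma cnf_satP (W : finType) (a : {ffun W -> bool}) (F : cnf W) :
  reflect (forall C : clause W, C \in F -> clause_sat a C) (cnf_sat a F).
Proof. exact: forall_inP. Qed.

Lemma entailsP F C :
  reflect (forall a, cnf_sat a F -> clause_sat a C) (entails F C).
Proof. exact: 'forall_implyP. Qed.

Lemma satisfiable_notin_set0 F : satisfiable F -> set0 \notin F.
Proof.
case=> a /cnf_satP aF; apply/negP => /aF /clause_satP[l].
by rewrite inE.
Qed.

Lemma satisfiable_not_entails_set0 F : satisfiable F -> ~~ entails F set0.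
Proof.
case=> a aF; apply/negP => /entailsP/(_ a aF)/clause_satP[l].
by rewrite inE.
Qed.

Lemma cnf_sat_and (a : {ffun V -> bool}) F A :
  cnf_sat a (cnf_and F A) = cnf_sat a F && [forall l in A, lit_sat a l].
Proof.
apply/cnf_satP/andP => [aFA|[/cnf_satP aF /forall_inP aA] C].
  split; first by apply/cnf_satP => C CF; apply: aFA; rewrite inE CF.
  apply/forall_inP => l lA; rewrite -clause_sat1; apply: aFA.
  by rewrite inE imset_f ?orbT.
by rewrite inE => /orP[/aF //|/imsetP[l /aA al ->]]; rewrite clause_sat1.
Qed.

(** Deduction theorem: an assignment falsifying some literal of [A] satisfies the larger clause
    through its negation, and any other model of [F] is a model of [cnf_and F A]. *)
Lemma entails_cnf_and F A C :
  entails (cnf_and F A) C = entails F (C :|: [set neg l | l in A]).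
Proof.
apply/entailsP/entailsP => [FA a aF | FA a].
- have [aA|/forall_inPn[l lA al]] := boolP [forall l in A, lit_sat a l].
    have /FA/clause_satP[l lC al] : cnf_sat a (cnf_and F A).
      by rewrite cnf_sat_and aF.
    by apply/clause_satP; exists l; rewrite ?inE ?lC.
  apply/clause_satP; exists (neg l); last by rewrite lit_sat_neg.
  by rewrite inE imset_f ?orbT.
- rewrite cnf_sat_and => /andP[/FA /clause_satP[l lCA al] /forall_inP aA].
  move: lCA; rewrite inE => /orP[lC|/imsetP[e /aA ae le]].
    by apply/clause_satP; exists l.
  by move: al; rewrite le lit_sat_neg ae.
Qed.

Lemma entails_cnf_andS F A A' C :
  A \subset A' -> entails (cnf_and F A) C -> entails (cnf_and F A') C.
Proof.
move=> /subsetP sA /entailsP FA; apply/entailsP => a.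
rewrite cnf_sat_and => /andP[aF /forall_inP aA']; apply: FA.
by rewrite cnf_sat_and aF; apply/forall_inP => l /sA /aA'.
Qed.

(** * Models of the dual rail encoding as sets of literals *)

(** The premise of the implication that [DR] attaches to [(C, l)], evaluated at [S]. *)
Definition fires S C l : bool := [forall e in C :\ l, neg e \in S].

Lemma firesP S C l :
  reflect (forall e, e \in C -> e != l -> neg e \in S) (fires S C l).
Proof.
apply: (iffP forall_inP) => [fS e eC el | fS e].
  by apply: fS; rewrite !inE el.
by rewrite !inE => /andP[el eC]; apply: fS.
Qed.

Definition unit_closed S F : Prop :=
  forall C l, C \in F -> l \in C -> fires S C l -> l \in S.

Lemma DR_implication_sat S C l :
  clause_sat [ffun l => l \in S] (DR_implication C l)
    = (fires S C l ==> (l \in S)).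
Proof.
apply/clause_satP/implyP => [[m]|fS].
  rewrite inE => /orP[/set1P-> /eqP /=|/imsetP[e eC ->] /eqP /=]; rewrite ffunE //.
  by move=> neS /forall_inP/(_ e eC); rewrite neS.
have [/fS lS|/forall_inPn[e eC neS]] := boolP (fires S C l).
  by exists (l, true); rewrite ?setU11 // /lit_sat ffunE lS.
exists (neg e, false); last by rewrite /lit_sat ffunE /= (negbTE neS).
by rewrite inE; apply/orP; right; apply/imsetP; exists e.
Qed.

Lemma DR_consistency_sat S x :
  clause_sat [ffun l => l \in S] (DR_consistency x)
    = ~~ (((x, true) \in S) && ((x, false) \in S)).
Proof.
rewrite negb_and; apply/clause_satP/orP => [[m]|].
  by case/set2P=> -> /eqP /=; rewrite ffunE => ->; [left | right].
case=> h; first exists ((x, true), false); rewrite ?set21 //.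
  by rewrite /lit_sat ffunE (negbTE h).
by exists ((x, false), false); rewrite ?set22 // /lit_sat ffunE (negbTE h).
Qed.

Lemma DR_satP S F :
  cnf_sat [ffun l => l \in S] (DR F) <->
  no_complementary_pair S /\ unit_closed S F.
Proof.
split=> [/cnf_satP sat | [/no_complementary_pairP cS clS]].
- split=> [|C l CF lC].
  + have cS x : ~~ (((x, true) \in S) && ((x, false) \in S)).
      by rewrite -DR_consistency_sat sat // inE imset_f ?orbT.
    apply/no_complementary_pairP => -[x []] xS; have := cS x;
      by rewrite /neg xS ?andbT.
  + apply/implyP; rewrite -DR_implication_sat sat // inE.
    by apply/orP; left; apply/imset2P; exists C l.
- apply/cnf_satP => D; rewrite inE.
  case/orP=> [/imset2P[C l CF lC ->]|/imsetP[x _ ->]].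
    by rewrite DR_implication_sat; apply/implyP; apply: clS.
  by rewrite DR_consistency_sat negb_and -implybE; apply/implyP => /cS.
Qed.

(** Every assignment of the meta-variables is the indicator of a set of literals, and both encodings
    have the same consistency clauses, so only closure is compared. *)
Lemma equivalent_DR F (G : cnf V) :
  (forall S, no_complementary_pair S -> unit_closed S F <-> unit_closed S G)
  <-> equivalent (DR F) (DR G).
Proof.
split=> [FG a | FG S cS].
  have -> : a = [ffun l => l \in [set l | a l]].
    by apply/ffunP => l; rewrite ffunE inE.
  by apply/idP/idP => /DR_satP[cS clS]; apply/DR_satP; split=> //;
     apply/(FG _ cS).
have satFG := FG [ffun l => l \in S].
by split=> clS; [have [] := (DR_satP S G).1 | have [] := (DR_satP S F).1] => //;
   rewrite (satFG, =^~ satFG); apply/DR_satP.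
Qed.

(** * Prime implicates and closure under entailed literals *)

Lemma fires_entails F S C l :
  l \in C -> fires S C l -> entails F C -> entails (cnf_and F S) [set l].
Proof.
move=> lC /firesP fS /entailsP FC; rewrite entails_cnf_and.
apply/entailsP => a /FC /clause_satP[e eC ae]; apply/clause_satP; exists e => //.
rewrite !inE; have [//|el] := eqVneq e l.
by rewrite -(negK e) imset_f // fS.
Qed.

(** If [F] and [S] entail [l], the clause made of [l] and the negations of [S] is implied by [F], so
    it contains a prime implicate, and one propagation in that prime implicate yields [l]. The
    converse is soundness of propagation. *)
Lemma prime_implicates_closed F S : satisfiable F -> no_complementary_pair S ->
  unit_closed S (prime_implicates F) <->
  (forall l, entails (cnf_and F S) [set l] -> l \in S).
Proof.
move=> satF /no_complementary_pairP cS; split=> [clS l | clS C l].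
- rewrite entails_cnf_and => FlS; have [//|nlS] := boolP (l \in S).
  have neg_in e : (e \in [set neg l | l in S]) = (neg e \in S).
    by rewrite -{1}(negK e) mem_imset //; exact: can_inj negK.
  (* The clause is not a tautology, since [S] is consistent and [l] is assumed outside [S]. *)
  have imp : implicate F ([set l] :|: [set neg l | l in S]).
    rewrite /implicate FlS andbT; apply/no_complementary_pairP => e.
    rewrite !inE !neg_in negK; case/orP=> [/eqP->|neS].
      by rewrite negb_or nlS andbT; case: (l) => x b; rewrite /neg xpair_eqE /=;
         case: b; rewrite andbF.
    have := cS _ neS; rewrite negK => eS; rewrite negb_or eS andbT.
    by apply: contraNneq nlS => <-.
  have [P minP sP] := minset_exists imp.
  have PF : P \in prime_implicates F by rewrite inE.
  have PS e : e \in P -> e != l -> neg e \in S.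
    by move=> /(subsetP sP); rewrite !inE neg_in => /orP[/eqP->|//]; rewrite eqxx.
  have [lP|nlP] := boolP (l \in P).
    by case/negP: nlS; apply: (clS P) => //; apply/firesP.
  (* Otherwise [S] falsifies all of [P]. As [P] is nonempty, it propagates one of its own literals
     [e] into [S], next to [neg e]. *)
  have {}PS e : e \in P -> neg e \in S.
    by move=> eP; apply: PS => //; apply: contraNneq nlP => <-.
  have /set0Pn[e eP] : P != set0.
    apply: contraNneq (satisfiable_not_entails_set0 satF) => <-.
    by case/minsetP: minP => /andP[].
  have eS : e \in S by apply: (clS P) => //; apply/firesP => f fP _; apply: PS.
  by have := cS _ eS; rewrite PS.
- rewrite inE => /minsetP[/andP[_ FC] _] lC fS; apply: clS.
  exact: fires_entails lC fS FC.
Qed.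

(** * Unit resolution against closed sets of literals *)

Lemma unit_derives_setD F C (s : seq (literal V)) :
  unit_derives F C -> (forall e, e \in s -> unit_derives F [set neg e]) ->
  unit_derives F (C :\: [set:: s]).
Proof.
move=> FC; elim: s => [|e s IHs] Fs; first by rewrite set_nil setD0.
rewrite set_cons setUC -setDDl.
have {}IHs : unit_derives F (C :\: [set:: s]).
  by apply: IHs => f fs; apply: Fs; rewrite inE fs orbT.
have [eC|neC] := boolP (e \in C :\: [set:: s]).
  by apply: unit_derives_res => //; apply: Fs; rewrite mem_head.
by rewrite (setDidPl _) // disjoint_sym disjoints1.
Qed.

Lemma unit_derives_fires F S C l :
  unit_derives F C -> l \in C -> fires S C l ->
  (forall e, e \in S -> unit_derives F [set e]) -> unit_derives F [set l].
Proof.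
move=> FC lC /forall_inP fS FS.
have -> : [set l] = C :\: [set:: enum (C :\ l)].
  apply/setP => e; rewrite !inE mem_enum !inE negb_and negbK.
  by have [->|] := eqVneq e l; rewrite ?lC //= andNb.
by apply: unit_derives_setD => // e; rewrite mem_enum => /fS /FS.
Qed.

(** Induction on the derivation: a consistent closed [S] stays closed under every derived clause,
    which bounds from above what unit resolution can derive. *)
Lemma unit_derives_invariant F S C :
  satisfiable F -> no_complementary_pair S -> unit_closed S F ->
  unit_derives (cnf_and F S) C ->
  C != set0 /\ (forall l, l \in C -> fires S C l -> l \in S).
Proof.
move=> satF /no_complementary_pairP cS clS.
elim=> {C} [C|C l _ [_ clC] lC _ [_ clN]].
- rewrite inE => /orP[CF|/imsetP[l lS ->]]; last first.
    by split=> [|e /set1P-> //]; apply/set0Pn; exists l; rewrite set11.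
  split=> [|l lC]; last exact: clS.
  by apply: contraNneq (satisfiable_notin_set0 satF) => <-.
- have nlS : neg l \in S.
    apply: clN; rewrite ?set11 //; apply/firesP => e.
    by move=> /set1P->; rewrite eqxx.
  (* The literal resolved away is already falsified by [S]. *)
  have fireE e : fires S (C :\ l) e -> fires S C e.
    move=> /firesP fS; apply/firesP => f fC fe.
    by have [->//|fl] := eqVneq f l; apply: fS; rewrite // !inE fl.
  split=> [|e]; last by rewrite !inE => /andP[_ eC] /fireE; exact: clC.
  (* An empty resolvent means that [C] is the unit clause of [l], which would put [l] into [S]
     beside [neg l]. *)
  apply/eqP => C0; suff lS : l \in S by have := cS _ lS; rewrite nlS.
  by apply: clC => //; apply: fireE; rewrite C0; apply/firesP => e; rewrite !inE.
Qed.

(** One round of unit propagation; [A] is added in each round so that the least fixpoint, iterated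
    from the empty set, contains it. *)
Definition propagate F A S : {set literal V} :=
  A :|: [set l | [exists C in F, (l \in C) && fires S C l]].

Definition propagation_closure F A : {set literal V} := fixset (propagate F A).

Lemma propagate_mono F A : {homo propagate F A : S S' / S \subset S'}.
Proof.
move=> S S' /subsetP sS; apply: setUS; apply/subsetP => l; rewrite !inE.
case/exists_inP=> C CF /andP[lC /forall_inP fS]; apply/exists_inP; exists C => //.
by rewrite lC; apply/forall_inP => e /fS /sS.
Qed.

Lemma propagation_closureE F A :
  propagate F A (propagation_closure F A) = propagation_closure F A.
Proof. exact/fixsetK/propagate_mono. Qed.

Lemma sub_propagation_closure F A : A \subset propagation_closure F A.
Proof. by rewrite -propagation_closureE subsetUl. Qed.

Lemma propagation_closure_closed F A : unit_closed (propagation_closure F A) F.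
Proof.
move=> C l CF lC fC; rewrite -propagation_closureE !inE; apply/orP; right.
by apply/exists_inP; exists C; rewrite ?lC.
Qed.

Lemma propagation_closure_derives F A l :
  l \in propagation_closure F A -> unit_derives (cnf_and F A) [set l].
Proof.
(* Induction on the number of rounds. *)
rewrite /propagation_closure /fixset; elim: #|_| l => [|n IHn] l; first by rewrite inE.
rewrite iterS inE => /orP[lA|].
  by apply: unit_derives_mem; rewrite inE imset_f ?orbT.
rewrite inE => /exists_inP[C CF /andP[lC fC]].
apply: unit_derives_fires lC fC IHn.
by apply: unit_derives_mem; rewrite inE CF.
Qed.

Lemma propagation_complete_closed F : satisfiable F ->
  propagation_complete F <->
  (forall S, no_complementary_pair S -> unit_closed S F ->
   forall l, entails (cnf_and F S) [set l] -> l \in S).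
Proof.
move=> satF; split=> [pcF S cS clS l FSl | clF A _ l FAl].
  (* The invariant turns a derived unit clause into membership in [S] and excludes the empty
     clause. *)
  have [] := pcF S cS l FSl => /(unit_derives_invariant satF cS clS)[].
    move=> _; apply; rewrite ?set11 //; apply/firesP => e /set1P->.
    by rewrite eqxx.
  by rewrite eqxx.
set S := propagation_closure F A.
have SA e : e \in S -> unit_derives (cnf_and F A) [set e].
  exact: propagation_closure_derives.
have [cS|] := boolP (no_complementary_pair S).
  left; apply: SA; apply: clF => //; first exact: propagation_closure_closed.
  exact: entails_cnf_andS (sub_propagation_closure F A) FAl.
(* Propagation produced a complementary pair, whose two unit clauses resolve to the empty clause. *)
case/forall_inPn=> e /SA Fe; rewrite negbK => /SA Fne; right.
by rewrite -(setDv [set e]); apply: unit_derives_res; rewrite ?set11.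
Qed.

End DualRail.

Theorem theorem5 (V : finType) (phi : cnf V) (phi_sat : satisfiable phi) :
  propagation_complete phi <-> equivalent (DR phi) (DR (prime_implicates phi)).
Proof.
apply: (iff_trans (propagation_complete_closed phi_sat)).
apply: iff_trans (equivalent_DR phi (prime_implicates phi)).
split=> [pc S cS | phi_psi S cS /(phi_psi S cS)]; last first.
  by move/(prime_implicates_closed phi_sat cS).
split=> [clS|/(prime_implicates_closed phi_sat cS) clS C l Cphi lC fC].
  exact/(prime_implicates_closed phi_sat cS)/pc.
(* A literal propagated by a clause of [phi] is entailed by [phi] and [S], hence lies in [S]. *)
apply: clS; apply: fires_entails lC fC _.
by apply/entailsP => a /cnf_satP; apply.
Qed.
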